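(* Let $\rho>0$ and let $\mathcal{G}^*$ be an optimal guessing strategy for the $\rho$-th moment of the guessing cost of $X$, i.e. a strategy minimizing $\mathbb{E}[C_{\mathcal{G}}(X)^\rho]$ over all guessing strategies $\mathcal{G}$. Write $p_i=P_X((\mathcal{G}^* )^{-1}(i))$ and let $c_i$ be the cost of $(\mathcal{G}^* )^{-1}(i)$, for $i\in[M]$. Then for all $i,j\in[M]$ with $i\le j$, $$\left[\|\mathbf{c}^{(i)}\|_1^\rho-\|\mathbf{c}^{(j)}\|_1^\rho\right]p_i+\left[\|\mathbf{c}^{(j)}\|_1^\rho-\left(\|\mathbf{c}^{(i)}\|_1-c_i+c_j\right)^\rho\right]p_j\le\sum_{l=i+1}^{j-1}\left[\left(\|\mathbf{c}^{(l)}\|_1-c_i+c_j\right)^\rho-\|\mathbf{c}^{(l)}\|_1^\rho\right]p_l .$$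
   Context: $X$ is a random variable on a finite set $\mathcal{X}$ with $|\mathcal{X}|=M$ and distribution $P_X$; each $x\in\mathcal{X}$ has a fixed real cost $c_x\ge 1$. $[M]=\{1,\dots,M\}$. A guessing strategy is a bijection $\mathcal{G}:\mathcal{X}\to[M]$ ($\mathcal{G}(x)$ is the position at which $x$ is guessed). The guessing cost is the accumulated cost of all guesses up to and including the correct one: $C_{\mathcal{G}}(x)=\sum_{j=1}^{\mathcal{G}(x)}c_{\mathcal{G}^{-1}(j)}$, so $\mathbb{E}[C_{\mathcal{G}}(X)^\rho]=\sum_{i=1}^M P_X(\mathcal{G}^{-1}(i))\left[\sum_{j=1}^i c_{\mathcal{G}^{-1}(j)}\right]^\rho$. For the vector $\mathbf{c}=(c_1,\dots,c_M)$ of costs in guessing order, $\mathbf{c}^{(l)}=(c_1,\dots,c_l)$ and $\|\mathbf{c}^{(l)}\|_1=\sum_{k=1}^l c_k$. Empty sums are $0$. *)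

(* Defs.v *)
From mathcomp Require Import all_boot all_order all_algebra.
From mathcomp Require Import reals exp.

Set Implicit Arguments.
Unset Strict Implicit.
Unset Printing Implicit Defensive.

Import Order.TTheory GRing.Theory Num.Theory.
Local Open Scope ring_scope.

Definition is_distribution (R : realType) (T : finType) (P : T -> R) : Prop :=
  (forall x, 0 <= P x) /\ \sum_x P x = 1.

(* A bijection of T onto [M], M = #|T|, packaged with its inverse.
   Positions are numbered from 0: the ordinal i stands for position i + 1. *)
Record strategy (T : finType) := Strategy {
  position : T -> 'I_#|T|;
  guess : 'I_#|T| -> T;
  positionK : cancel position guess;
  guessK : cancel guess position
}.

(* The sum of the first l + 1 entries, that is, the l1-norm of the prefix of c
   ending at the 0-based index l, when c is nonnegative. *)
Definition prefix_norm (R : realType) (n : nat) (c : 'I_n -> R) (l : 'I_n) : R :=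
  \sum_(k < n | (k <= l)%N) c k.

Definition guessing_cost (R : realType) (T : finType) (cost : T -> R)
    (G : strategy T) (x : T) : R :=
  \sum_(j < #|T| | (j <= position G x)%N) cost (guess G j).

(* Expectation of the rho-th power of the guessing cost of X, X ~ P. *)
Definition guessing_moment (R : realType) (T : finType) (P : T -> R)
    (cost : T -> R) (rho : R) (G : strategy T) : R :=
  \sum_x P x * guessing_cost cost G x `^ rho.

Definition optimal_strategy (R : realType) (T : finType) (P : T -> R)
    (cost : T -> R) (rho : R) (G : strategy T) : Prop :=
  forall G' : strategy T,
    guessing_moment P cost rho G <= guessing_moment P cost rho G'.

(* Main.v *)
Require Import Defs.
From mathcomp Require Import all_boot all_order all_algebra.
From mathcomp Require Import perm.
From mathcomp Require Import reals exp.
From mathcomp Require Import lra.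

Import Order.TTheory GRing.Theory Num.Theory.
Local Open Scope ring_scope.

(** Exchange argument: interchange the guesses at positions i and j of an
    optimal strategy.  Positions before i and after j keep their accumulated
    cost, positions from i to j - 1 have it changed by c_j - c_i, and the two
    interchanged guesses trade probabilities.  The stated inequality says that
    the moment of the modified strategy is not smaller. *)

Definition swap_guesses (T : finType) (G : strategy T) (i j : 'I_#|T|) :
  strategy T.
Proof.
refine (@Strategy T (fun x => tperm i j (position G x))
                    (fun k => guess G (tperm i j k)) _ _).
- by move=> x; rewrite tpermK positionK.
- by move=> k; rewrite guessK tpermK.
Defined.

Lemma guessing_moment_positions (R : realType) (T : finType) (P : T -> R)
    (cost : T -> R) (rho : R) (G : strategy T) :
  guessing_moment P cost rho G =
  \sum_(l < #|T|)
    P (guess G l) * prefix_norm (fun k => cost (guess G k)) l `^ rho.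
Proof.
rewrite /guessing_moment (reindex (guess G)) /=; last first.
  by exists (position G) => x _; rewrite ?guessK ?positionK.
by apply: eq_bigr => l _; rewrite /guessing_cost guessK.
Qed.

(** In the difference of the two prefix sums only the indices [i] and [j] survive: [i] contributes
    [c j - c i] once [i <= l], and [j] cancels this once [j <= l]. *)
Lemma prefix_norm_tperm (R : realType) (n : nat) (c : 'I_n -> R)
    (i j l : 'I_n) : (i < j)%N ->
  prefix_norm (fun k => c (tperm i j k)) l =
  prefix_norm c l + (if (i <= l < j)%N then c j - c i else 0).
Proof.
move=> ltij; have neji : j != i by apply: contraTneq ltij => ->; rewrite ltnn.
apply/eqP; rewrite addrC -subr_eq -sumrB big_mkcond (bigD1 i) //= (bigD1 j) //=.
rewrite tpermL tpermR big1 => [|k /andP[ki kj]]; last first.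
  by rewrite tpermD 1?eq_sym // subrr if_same.
rewrite addr0; case: (leqP j l) => [lejl|ltlj].
  by rewrite (leq_trans (ltnW ltij) lejl) /= addrC subrKA subrr.
by rewrite andbT addr0.
Qed.

Theorem proposition2p1 (R : realType) (T : finType) (P : T -> R)
    (cost : T -> R) (rho : R) (G : strategy T)
    (hP : is_distribution P) (hcost : forall x, 1 <= cost x)
    (hrho : 0 < rho) (hG : optimal_strategy P cost rho G) :
  let p := fun i : 'I_#|T| => P (guess G i) in
  let c := fun i : 'I_#|T| => cost (guess G i) in
  forall i j : 'I_#|T|, (i <= j)%N ->
    (prefix_norm c i `^ rho - prefix_norm c j `^ rho) * p i
    + (prefix_norm c j `^ rho - (prefix_norm c i - c i + c j) `^ rho) * p j
    <= \sum_(l < #|T| | (i < l < j)%N)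
         ((prefix_norm c l - c i + c j) `^ rho - prefix_norm c l `^ rho) * p l.
Proof.
move=> p c i j; rewrite leq_eqVlt => /predU1P[/val_inj <-|ltij].
  (* For [i = j] both sides are 0, the sum being empty. *)
  rewrite subrK !subrr !mul0r addr0 big_pred0 // => l.
  by apply/negP => /andP[/ltn_trans h /h]; rewrite ltnn.
have neji : j != i by apply: contraTneq ltij => ->; rewrite ltnn.
have := hG (swap_guesses _ G i j).
rewrite -subr_ge0 !guessing_moment_positions -sumrB.
under eq_bigr => l _ do
  rewrite -/(p l) -/c /= -/(p (tperm i j l)) (prefix_norm_tperm _ _ c) //.
(* The terms at [i] and [j], where the probabilities are traded, add up to minus the left-hand
   side. *)
rewrite (bigD1 i) //= (bigD1 j) //= tpermL tpermR leqnn ltij ltnn andbF addr0.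
set rest := \sum_(l < _ | _) _.
have -> : rest = \sum_(l < #|T| | (i < l < j)%N)
    ((prefix_norm c l - c i + c j) `^ rho - prefix_norm c l `^ rho) * p l.
  (* Away from [i] and [j] the probability is unchanged, so a term vanishes unless its prefix norm
     is shifted, that is, unless [i < l < j]. *)
  rewrite /rest big_mkcond [RHS]big_mkcond; apply: eq_bigr => l _.
  have [->|neli] := eqVneq l i; first by rewrite ltnn.
  have [->|nelj] := eqVneq l j; first by rewrite ltnn !andbF.
  have -> : (i <= l)%N = (i < l)%N.
    by rewrite [RHS]ltn_neqAle eq_sym (inj_eq val_inj) neli.
  rewrite /= tpermD 1?eq_sym //; case: ifP => _; last by rewrite addr0 subrr.
  by rewrite addrA addrAC -mulrBr mulrC.
rewrite addrA addrAC; set S := \sum_(_ < _ | _) _.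
(* The powers are opaque to [lra], so the shifted base must first read exactly as in the goal. *)
rewrite [prefix_norm c i + _]addrA [prefix_norm c i + _ - _]addrAC.
lra.
Qed.
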